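(* For every integer $n\ge 5$, the boxicity of the Kneser graph $Kn(2,n)$ is either $n-3$ or $n-2$.
   Context: An axis-parallel $d$-dimensional box is a cartesian product $I_1\times I_2\times\dots\times I_d$ where each $I_i$ is a closed sub-interval of the real line (the whole line $\mathbb R$ is allowed). For a finite graph $G=(V,E)$, the boxicity of $G$ is the minimum dimension $d\geq 0$ such that $G$ is the intersection graph of a family $(B_v)_{v\in V}$ of $d$-dimensional axis-parallel boxes in $\mathbb R^d$, i.e. distinct $u,v\in V$ are adjacent if and only if $B_u\cap B_v\ne\varnothing$. The Kneser graph $Kn(2,n)$ has as vertices all $2$-element subsets of $[n]=\{1,\dots,n\}$, two vertices being adjacent if the corresponding sets are disjoint. *)

(* Defs.v *)
From HB Require Import structures.
From mathcomp Require Import all_boot all_order all_algebra.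
From mathcomp Require Import all_classical all_reals all_analysis.
Import numFieldNormedType.Exports.

Set Implicit Arguments.
Unset Strict Implicit.
Unset Printing Implicit Defensive.

Record sgraph := SGraph {
  svertex :> finType;
  sadj : rel svertex;
  sadj_sym : symmetric sadj;
  sadj_irrefl : irreflexive sadj }.

Definition pair_vertex (n : nat) : finType :=
  {A : {set 'I_n} | #|A| == 2%N}.

Definition pair_disjoint (n : nat) : rel (pair_vertex n) :=
  fun A B => [disjoint val A & val B].

Lemma pair_disjoint_sym n : symmetric (@pair_disjoint n).
Proof. by move=> A B; rewrite /pair_disjoint disjoint_sym. Qed.

Lemma pair_disjoint_irrefl n : irreflexive (@pair_disjoint n).
Proof.
move=> [A cA]; rewrite /pair_disjoint /= -finset.setI_eq0 finset.setIid.
by apply/negbTE; rewrite -card_gt0 (eqP cA).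
Qed.

Definition kneser2 (n : nat) : sgraph :=
  SGraph (@pair_disjoint_sym n) (@pair_disjoint_irrefl n).

Local Open Scope classical_set_scope.

(* Half-lines and the whole line are included; [is_interval] is convexity, so
   nonemptiness has to be required separately. *)
Definition closed_interval (R : realType) (I : set R) : Prop :=
  [/\ is_interval I, closed I & I !=set0].

Definition box (R : realType) (d : nat) (B : set 'rV[R]_d) : Prop :=
  exists2 I : 'I_d -> set R, (forall i, closed_interval (I i)) &
    B = [set x | forall i, I i (x ord0 i)].

Definition box_representation (R : realType) (G : sgraph) (d : nat)
    (B : G -> set 'rV[R]_d) : Prop :=
  (forall v, box (B v)) /\
  (forall u v, u != v -> sadj u v <-> B u `&` B v !=set0).

Definition box_representable (R : realType) (G : sgraph) (d : nat) : Prop :=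
  exists B : G -> set 'rV[R]_d, box_representation B.

Definition is_boxicity (R : realType) (G : sgraph) (d : nat) : Prop :=
  box_representable R G d /\
  (forall d', box_representable R G d' -> (d <= d')%N).

(* Main.v *)
(* Regard the vertices of Kn(2,n) as the edges of K_n, so that non-adjacent
   vertices are edges sharing an endpoint.

   Upper bound: call two vertices of K_n extreme (0 and n-1) and use one
   coordinate for each of the n-2 other vertices i.  The edge {i,j} becomes the
   point j, and an edge avoiding i becomes [0,n-1], shortened to start at 1 if it
   contains 0 and to end at n-2 if it contains n-1.

   Lower bound: each coordinate of a box representation gives an interval order
   on the edges of K_n, in which comparable edges meet, and every pair of
   intersecting edges is comparable in some coordinate.  Two disjoint cross-intersecting
   families with at least three edges each lie in a common star, which bounds
   the number of comparable pairs of such an order by (n^2 + n + 2) / 2, while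
   K_n has n(n-1)(n-2)/2 pairs of intersecting edges. *)
Require Import Defs.
From mathcomp Require Import all_boot all_order all_algebra.
From mathcomp Require Import all_classical all_reals all_analysis.
From mathcomp Require Import zify.

Set Implicit Arguments.
Unset Strict Implicit.
Unset Printing Implicit Defensive.

Import Order.TTheory GRing.Theory Num.Theory.

(** * Cross-intersecting families of pairs *)

Section Pairs.
Variable n : nat.
Implicit Types (e f g : pair_vertex n) (a b c x y : 'I_n).
Implicit Types A S F : {set pair_vertex n}.

Lemma pair_vertex_split e a : a \in val e ->
  exists2 b, b != a & val e = [set a; b].
Proof.
move=> ae; have /cards1P[b eb] : #|val e :\ a| == 1%N.
  by have := cardsD1 a (val e); rewrite ae (eqP (valP e)) => /eqP; rewrite eqSS eq_sym.
exists b; last by rewrite -eb finset.setD1K.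
have : b \in val e :\ a by rewrite eb finset.in_set1.
by rewrite finset.in_setD1 => /andP[].
Qed.

Lemma pair_vertex_ends e : exists a b,
  [/\ a \in val e, b \in val e & a != b].
Proof.
have /card_gt0P[a ae] : (0 < #|val e|)%N by rewrite (eqP (valP e)).
have [b ba eab] := pair_vertex_split ae.
by exists a, b; rewrite eq_sym ba eab !finset.inE !eqxx orbT.
Qed.

Lemma pair_vertex_mem e a b c : a != b -> a \in val e -> b \in val e ->
  c \in val e -> c = a \/ c = b.
Proof.
move=> ab /pair_vertex_split[d da ->]; rewrite !finset.inE.
rewrite eq_sym (negbTE ab) => /eqP -> /orP[] /eqP ->; by [left|right].
Qed.

Lemma pair_vertex_eq e f a b : a != b -> a \in val e -> b \in val e ->
  a \in val f -> b \in val f -> e = f.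
Proof.
move=> ab ae be af bf; apply: val_inj; apply/finset.setP => c.
apply/idP/idP => [ce|cf].
  by case: (pair_vertex_mem ab ae be ce) => ->.
by case: (pair_vertex_mem ab af bf cf) => ->.
Qed.

(** Adjacency in the line graph of the complete graph; for distinct vertices this is non-adjacency
    in the Kneser graph. *)
Definition pair_meet e f := (e != f) && ~~ [disjoint val e & val f].

Lemma pair_meet_sym e f : pair_meet e f = pair_meet f e.
Proof. by rewrite /pair_meet eq_sym disjoint_sym. Qed.

Lemma pair_meet_common e f : pair_meet e f ->
  exists2 a, a \in val e & a \in val f.
Proof. by case/andP=> _ /pred0Pn[a /andP[]]; exists a. Qed.

Lemma pair_meet_off e f a : pair_meet e f -> a \in val e -> a \notin val f ->
  exists b, [/\ a != b, b \in val e & b \in val f].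
Proof.
move=> /pair_meet_common[b be bf] ae af; exists b; split=> //.
by apply: contra af => /eqP ->.
Qed.

Lemma pair_meet_eqF e f a b : pair_meet e f -> a != b ->
  a \in val e -> b \in val e -> a \in val f -> b \in val f -> False.
Proof.
by move=> ef ab ae be af bf; case/andP: ef; rewrite (pair_vertex_eq ab ae be af bf) eqxx.
Qed.

Definition star a : {set pair_vertex n} := [set e : pair_vertex n | a \in val e].

(** An edge at [a] is determined by its other end, so [F] injects into [X]. *)
Lemma card_sub_star a F (X : {set 'I_n}) : F \subset star a ->
  (forall e b, e \in F -> b \in val e -> b != a -> b \in X) -> #|F| <= #|X|.
Proof.
move=> /fintype.subsetP Fa FX; rewrite -(card_imset _ val_inj).
apply: leq_trans (leq_imset_card (fun b => [set a; b]) X).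
apply/subset_leq_card/fintype.subsetP => _ /imsetP[e eF ->].
have := Fa _ eF; rewrite finset.inE => /pair_vertex_split[b ba eb].
apply/imsetP; exists b => //; apply: (FX e) => //.
by rewrite eb !finset.inE eqxx orbT.
Qed.

Definition cross A S := forall e f, e \in A -> f \in S -> pair_meet e f.

Lemma cross_sym A S : cross A S -> cross S A.
Proof. by move=> AS f e fS eA; rewrite pair_meet_sym; apply: AS. Qed.

Lemma cross_cover A S e a b : cross A S -> e \in A -> a != b ->
  a \in val e -> b \in val e -> S = (S :&: star a) :|: (S :&: star b).
Proof.
move=> AS eA ab ae be; apply/finset.setP => f; rewrite !finset.inE -andb_orr.
case fS: (f \in S) => //=; apply/esym/orP.
have [c ce cf] := pair_meet_common (AS _ _ eA fS).
by case: (pair_vertex_mem ab ae be ce) => <-; [left|right].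
Qed.

(** Members of [S] contain an end of a fixed edge [e] of [A] but differ from [e], which leaves at
    most [n - 2] of them at each end. *)
Lemma cross_card1 A S : cross A S -> 0 < #|A| -> #|S| <= 2 * (n - 2).
Proof.
move=> AS /card_gt0P[e eA]; have [a [b [ae be ab]]] := pair_vertex_ends e.
have bnd u v : u != v -> u \in val e -> v \in val e ->
    #|S :&: star u| <= n - 2.
  move=> uv ue ve; apply: leq_trans (_ : #|~: [set u; v]| <= _); last first.
    by rewrite finset.cardsCs finset.setCK cards2 uv card_ord.
  apply: (card_sub_star (finset.subsetIr _ _)) => f c.
  rewrite !finset.inE => /andP[fS uf] cf cu; rewrite (negbTE cu) /=.
  apply/negP => /eqP cv; rewrite cv in cf.
  exact: (pair_meet_eqF (AS _ _ eA fS) uv).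
rewrite (cross_cover AS eA ab ae be).
have := bnd _ _ ab ae be; have := bnd b a; rewrite eq_sym => /(_ ab be ae).
have := cardsUI (S :&: star a) (S :&: star b); lia.
Qed.

(** An edge of [S] avoiding [a] must join the other ends of [e] and [e'], which are distinct. *)
Lemma cross_off_star A S e e' a : cross A S -> e \in A -> e' \in A ->
  e != e' -> a \in val e -> a \in val e' -> #|S :\: star a| <= 1.
Proof.
move=> AS eA eA' ee' ae ae'; apply/card_le1_eqP => f g.
have off h : h \in S :\: star a -> exists b c,
    [/\ b \in val e, c \in val e', a != b, a != c & b \in val h /\ c \in val h].
  rewrite !finset.inE => /andP[ah hS].
  have [b [ab be bh]] := pair_meet_off (AS _ _ eA hS) ae ah.
  by have [c [ac ce ch]] := pair_meet_off (AS _ _ eA' hS) ae' ah; exists b, c.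
move=> /off[b [c [be ce ab ac [bf cf]]]] /off[b' [c' [be' ce' ab' ac' [bg cg]]]].
have bb : b' = b.
  by case: (pair_vertex_mem ab ae be be') => // E; rewrite E eqxx in ab'.
have cc : c' = c.
  by case: (pair_vertex_mem ac ae' ce ce') => // E; rewrite E eqxx in ac'.
rewrite bb cc in bg cg; apply: (@pair_vertex_eq _ _ b c) => //.
apply: contra ee' => /eqP E; rewrite -E in ce.
by apply/eqP; apply: (@pair_vertex_eq _ _ a b).
Qed.

(** Take two edges of [A]. If they are disjoint, [S] lies among the four edges joining them, and
    [4 <= n - 1]; if they share [a], then [S] has at most [n - 2] edges at [a] and one off it. *)
Lemma cross_card2 A S : 5 <= n -> cross A S -> 1 < #|A| -> #|S| <= n - 1.
Proof.
move=> n5 AS /card_gt1P[e [e' [eA eA' ee']]].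
have [dis|] := boolP [disjoint val e & val e'].
  have [a [b [ae be ab]]] := pair_vertex_ends e.
  have bnd u : u \in val e -> #|S :&: star u| <= 2.
    move=> ue; rewrite -(eqP (valP e')).
    apply: (card_sub_star (finset.subsetIr _ _)) => f c.
    rewrite !finset.inE => /andP[fS uf] cf cu.
    have [d de df] := pair_meet_common (AS _ _ eA' fS).
    have [| E|<-//] := pair_vertex_mem _ uf cf df; first by rewrite eq_sym.
    by move/pred0P: dis => /(_ u) /=; rewrite ue -E de.
  rewrite (cross_cover AS eA ab ae be).
  have := bnd _ ae; have := bnd _ be.
  have := cardsUI (S :&: star a) (S :&: star b); lia.
case/pred0Pn=> a /andP[/= ae ae'].
have off := cross_off_star AS eA eA' ee' ae ae'.
have := ae; have := ae'.
move=> /pair_vertex_split[c ca e'E] /pair_vertex_split[b ba eE].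
have be : b \in val e by rewrite eE !finset.inE eqxx orbT.
have ce : c \in val e' by rewrite e'E !finset.inE eqxx orbT.
have ab : a != b by rewrite eq_sym.
have ac : a != c by rewrite eq_sym.
have : #|S :&: star a| <= #|~: [set a; b]|.
  apply: (card_sub_star (finset.subsetIr _ _)) => f d.
  rewrite !finset.inE => /andP[fS af] df da; rewrite (negbTE da) /=.
  apply/negP => /eqP E; rewrite E in df.
  exact: (pair_meet_eqF (AS _ _ eA fS) ab).
rewrite [#|~: _|]finset.cardsCs finset.setCK cards2 ab card_ord => on.
by rewrite -(cardsID (star a) S); move: (leq_add on off); clear -n5; lia.
Qed.

(** An edge [g] of [A] missing [a] would join the other ends of [f1] and [f2], and two edges [e1],
    [e2] of [A] would contain [a]. A third edge of [S], if it contains [a], equals [f1] or [f2];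
    otherwise it joins the other ends of [e1] and [e2], and meeting [g] it forces some [ei = fj]. *)
Lemma cross_sub_star A S f1 f2 a : cross A S -> 2 < #|A| -> 2 < #|S| ->
  f1 \in S -> f2 \in S -> f1 != f2 -> a \in val f1 -> a \in val f2 ->
  A \subset star a.
Proof.
move=> AS A3 S3 f1S f2S f12 af1 af2; apply/fintype.subsetP => g gA.
rewrite finset.inE; apply/negPn/negP => ag.
have SA := cross_sym AS.
have Aoff := cross_off_star SA f1S f2S f12 af1 af2.
have /card_gt1P[e1 [e2 []]] : 1 < #|A :&: star a|.
  by have := cardsID (star a) A; lia.
rewrite !finset.inE => /andP[e1A ae1] /andP[e2A ae2] e12.
have /card_gt0P[f] : 0 < #|S :\: [set f1; f2]|.
  rewrite finset.cardsD subn_gt0; apply: leq_ltn_trans S3.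
  by apply: leq_trans (subset_leq_card (finset.subsetIr _ _)) _; rewrite cards2 f12.
rewrite !finset.inE negb_or => /andP[/andP[ff1 ff2] fS].
have [x [ax xf xg]] := pair_meet_off (SA _ _ f1S gA) af1 ag.
have [y [ay yf yg]] := pair_meet_off (SA _ _ f2S gA) af2 ag.
have xy : x != y.
  apply: contra f12 => /eqP E; rewrite -E in yf.
  by apply/eqP; apply: (@pair_vertex_eq _ _ a x).
have [c cg cf] := pair_meet_common (AS _ _ gA fS).
have [af|af] := boolP (a \in val f).
  case: (pair_vertex_mem xy xg yg cg) => E; subst c.
    by case/eqP: ff1; apply: (@pair_vertex_eq _ _ a x).
  by case/eqP: ff2; apply: (@pair_vertex_eq _ _ a y).
have [b [ab be bf]] := pair_meet_off (AS _ _ e1A fS) ae1 af.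
have [z [az ze zf]] := pair_meet_off (AS _ _ e2A fS) ae2 af.
have bz : b != z.
  apply: contra e12 => /eqP E; rewrite -E in ze.
  by apply/eqP; apply: (@pair_vertex_eq _ _ a b).
case: (pair_vertex_mem bz bf zf cf) => Ec; subst c;
  case: (pair_vertex_mem xy xg yg cg) => Ec; subst.
- exact: (pair_meet_eqF (AS _ _ e1A f1S) ab).
- exact: (pair_meet_eqF (AS _ _ e1A f2S) ab).
- exact: (pair_meet_eqF (AS _ _ e2A f1S) az).
- exact: (pair_meet_eqF (AS _ _ e2A f2S) az).
Qed.

(** By pigeonhole two edges of [S] share an end of an edge of [A], which puts [A], and then [S],
    into one star. The families are disjoint because [pair_meet] is irreflexive, and a star has
    [n - 1] edges. *)
Lemma cross_card3 A S : cross A S -> 2 < #|A| -> 2 < #|S| ->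
  #|A| + #|S| <= n - 1.
Proof.
move=> AS A3 S3; have SA := cross_sym AS.
have /card_gt0P[e eA] : 0 < #|A| := ltnW (ltnW A3).
have [u [v [ue ve uv]]] := pair_vertex_ends e.
have [a /card_gt1P[f1 [f2 []]]] : exists a, 1 < #|S :&: star a|.
  have := cardsUI (S :&: star u) (S :&: star v).
  rewrite -(cross_cover AS eA uv ue ve) => SE.
  by have [|] := ltnP 1 #|S :&: star u|; [exists u | exists v; lia].
rewrite !finset.inE => /andP[f1S af1] /andP[f2S af2] f12.
have Aa := cross_sub_star AS A3 S3 f1S f2S f12 af1 af2.
have /card_gt1P[e1 [e2 [e1A e2A e12]]] : 1 < #|A| := ltnW A3.
have Sa : S \subset star a.
  by apply: (cross_sub_star SA S3 A3 e1A e2A e12);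
    [have := fintype.subsetP Aa _ e1A|have := fintype.subsetP Aa _ e2A];
    rewrite finset.inE.
have <- : #|A :|: S| = #|A| + #|S|.
  apply/eqP; rewrite (leq_card_setU A S).2.
  apply/pred0P => f /=; apply/negbTE/negP => /andP[fA fS].
  by have := AS _ _ fA fS; rewrite /pair_meet eqxx.
apply: leq_trans (_ : #|~: [set a]| <= _); last first.
  by rewrite finset.cardsCs finset.setCK cards1 card_ord.
apply: (@card_sub_star a); first by rewrite finset.subUset Aa.
by move=> f b _ _; rewrite !finset.inE.
Qed.

End Pairs.

(** * Interval orders whose comparable pairs meet *)

(** Meant for [n = m + 5], with [s t] the size of the level set [t]; the bound is then
    [n^2 + n + 2]. *)
Lemma sum_level_bound m (s : nat -> nat) :
  s 0 <= 2 * m + 6 -> s 1 <= m + 4 ->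
  (forall t, 2 <= t -> s t <= 2 \/ s t + t <= m + 3) ->
  (forall t, m + 4 <= t -> s t <= 1) ->
  2 * \sum_(0 <= t < 2 * m + 6) s t <= m * m + 11 * m + 32.
Proof.
move=> s0 s1 s2 s3.
(* For [2 <= t <= m + 1] the value [m + 3 - t] is at least 2, so it covers both alternatives. *)
have head k : k <= m ->
    2 * \sum_(0 <= t < k.+2) s t + k * k <= 2 * (3 * m + 10) + k * (2 * m + 3).
  elim: k => [_|k IH km]; first by rewrite !big_nat_recr //= big_geq //; lia.
  rewrite big_nat_recr //=; have := IH (ltnW km).
  by case: (s2 k.+2 isT); nia.
have middle : \sum_(m.+2 <= t < m.+4) s t <= 4.
  rewrite big_nat_recr //= big_nat1.
  by case: (s2 m.+2 isT); case: (s2 m.+3 isT); lia.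
have tail : \sum_(m.+4 <= t < 2 * m + 6) s t <= m + 2.
  apply: leq_trans (_ : \sum_(m.+4 <= t < 2 * m + 6) 1 <= _); last first.
    by rewrite sum_nat_const_nat; lia.
  by rewrite !big_nat; apply: leq_sum => t /andP[tm _]; apply: s3; lia.
have -> : \sum_(0 <= t < 2 * m + 6) s t = \sum_(0 <= t < m.+2) s t +
    (\sum_(m.+2 <= t < m.+4) s t + \sum_(m.+4 <= t < 2 * m + 6) s t).
  by rewrite -!big_cat_nat //=; lia.
by have := head m (leqnn m); lia.
Qed.

(* Up-sets of an interval order form a chain, so every level set
   [{e | t < #|up e|}] is cross-intersecting with a single up-set of more than
   [t] elements; the count of comparable pairs is the sum of the level sizes. *)
Section IntervalOrder.
Variables (n : nat) (lt : rel (pair_vertex n)).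
Hypothesis n5 : 5 <= n.
Hypothesis lt_meet : forall e f, lt e f -> pair_meet e f.
Hypothesis lt_2p2 : forall u v u' v', lt u v -> lt u' v' -> lt u v' || lt u' v.

Let up e : {set pair_vertex n} := [set f : pair_vertex n | lt e f].
Let level t : {set pair_vertex n} := [set e : pair_vertex n | t < #|up e|].

(** If the inclusion failed, [lt_2p2] would give the reverse one, and the cardinalities would force
    equality. *)
Lemma upper_set_chain e e' : #|up e| <= #|up e'| -> up e \subset up e'.
Proof.
move=> le; have [//|/subsetPn[v]] := boolP (up e \subset up e').
rewrite !finset.inE => ev e'v.
have sub : up e' \subset up e.
  apply/fintype.subsetP => v'; rewrite !finset.inE => e'v'.
  by have := lt_2p2 ev e'v'; rewrite (negbTE e'v) orbF.
have /eqP/finset.setP/(_ v) : up e' == up e by rewrite eqEcard sub le.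
by rewrite !finset.inE ev (negbTE e'v).
Qed.

Lemma level_cross t : 0 < #|level t| ->
  exists2 S, cross (level t) S & t < #|S|.
Proof.
move=> /card_gt0P[e0 e0t].
(* A smallest up-set over the level is contained in all the others. *)
case: (@arg_minnP _ e0 (mem (level t)) (fun e => #|up e|) e0t) => e et emin.
exists (up e); last by move: et; rewrite /= finset.inE.
move=> f g ft ge; apply: lt_meet.
by have := fintype.subsetP (upper_set_chain (emin _ ft)) _ ge; rewrite finset.inE.
Qed.

Lemma upper_set_card e : #|up e| <= 2 * (n - 2).
Proof.
apply: (@cross_card1 _ [set e]); last by rewrite cards1.
by move=> _ f /finset.set1P -> ; rewrite finset.inE => /lt_meet.
Qed.

(** [#|up e|] counts the [t] below it, and [upper_set_card] allows the cut-off at [2 * (n - 2)]. *)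
Lemma sum_upper_set :
  \sum_e \sum_f (lt e f : nat) = \sum_(0 <= t < 2 * (n - 2)) #|level t|.
Proof.
rewrite big_mkord; transitivity (\sum_e \sum_(t < 2 * (n - 2)) (t < #|up e| : nat)).
  apply: eq_bigr => e _.
  have -> : \sum_f (lt e f : nat) = #|up e|.
    by rewrite -sum1dep_card [RHS]big_mkcond; apply: eq_bigr => f _; case: (lt e f).
  have := upper_set_card e; move: #|up e| => k.
  move=> kN; rewrite -[LHS]card_ord -sum1_card (big_ord_widen _ (fun=> 1) kN).
  by rewrite big_mkcond; apply: eq_bigr => t _; case: ltnP.
rewrite exchange_big; apply: eq_bigr => t _.
by rewrite -sum1dep_card [RHS]big_mkcond; apply: eq_bigr => e _; case: ltnP.
Qed.

Lemma interval_order_count :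
  2 * \sum_e \sum_f (lt e f : nat) <= n * n + n + 2.
Proof.
rewrite sum_upper_set.
have level_le t : [/\ #|level t| <= 2 * (n - 2),
    1 <= t -> #|level t| <= n - 1,
    2 <= t -> #|level t| <= 2 \/ #|level t| + t.+1 <= n - 1 &
    n - 1 <= t -> #|level t| <= 1].
  have [|/level_cross[S AS tS]] := posnP #|level t|.
    by move=> ->; split=> // _; left.
  have SA := cross_sym AS; have S0 := leq_ltn_trans (leq0n t) tS.
  split.
  - exact: cross_card1 SA S0.
  - by move=> t1; apply: (cross_card2 n5 SA); apply: leq_ltn_trans tS.
  - move=> t2; have [|A3] := leqP #|level t| 2; [by left|right].
    apply: leq_trans (cross_card3 AS A3 (leq_ltn_trans t2 tS)).
    by rewrite leq_add2l.
  (* Here [S] has more than [n - 1] members, which [cross_card2] forbids opposite two edges. *)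
  - move=> tn; rewrite leqNgt; apply/negP => A2.
    by have := leq_trans tS (cross_card2 n5 AS A2); rewrite ltnNge tn.
have [m nm] : exists m, n = m + 5 by exists (n - 5); rewrite subnK.
have -> : 2 * (n - 2) = 2 * m + 6 by rewrite nm; lia.
apply: leq_trans (@sum_level_bound m (fun t => #|level t|) _ _ _ _) _.
- by case: (level_le 0) => + _ _ _ => /leq_trans; apply; rewrite nm; lia.
- by case: (level_le 1) => _ /(_ isT) + _ _ => /leq_trans; apply; rewrite nm; lia.
- move=> t t2; case: (level_le t) => _ _ /(_ t2)[|H _]; first by left.
  by right; move: nm H; move: #|level t| => k; clear; lia.
- by move=> t tm; case: (level_le t) => _ _ _; apply; rewrite nm; clear -tm; lia.
- by rewrite nm; clear; nia.
Qed.

End IntervalOrder.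

(** * Counting intersecting pairs of edges *)

Lemma triples_count n :
  n * (n - 1) * (n - 2) = #|[set p : 'I_n * 'I_n * 'I_n |
    [&& p.1.2 != p.1.1, p.2 != p.1.1 & p.2 != p.1.2]]|.
Proof.
transitivity (\sum_(a < n) \sum_(b < n | b != a)
                \sum_(c < n | (c != a) && (c != b)) 1); last first.
  by rewrite !pair_big_dep sum1dep_card.
have inner (a b : 'I_n) : b != a -> \sum_(c < n | (c != a) && (c != b)) 1 = n - 2.
  move=> ba; rewrite sum1dep_card.
  have -> : [set c : 'I_n | (c != a) && (c != b)] = ~: [set a; b].
    by apply/finset.setP => c; rewrite !finset.inE negb_or.
  by rewrite finset.cardsCs finset.setCK cards2 eq_sym ba card_ord.
have middle (a : 'I_n) : \sum_(b < n | b != a)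
    \sum_(c < n | (c != a) && (c != b)) 1 = (n - 1) * (n - 2).
  rewrite (eq_bigr (fun=> n - 2)) => [|b]; last exact: inner.
  rewrite sum_nat_cond_const.
  have -> : [set c : 'I_n | c != a] = ~: [set a].
    by apply/finset.setP => c; rewrite !finset.inE.
  by rewrite finset.cardsCs finset.setCK cards1 card_ord.
under eq_bigr do rewrite middle.
by rewrite sum_nat_const card_ord mulnA.
Qed.

Lemma pair_vertex_of n (a b : 'I_n) : b != a ->
  exists e : pair_vertex n, val e = [set a; b].
Proof.
move=> ba; have c2 : #|[set a; b]| == 2 by rewrite cards2 [a == b]eq_sym ba.
by exists (Sub [set a; b] c2); rewrite SubK.
Qed.

(** Distinct [a, b, c] yield the intersecting edges [{a, b}] and [{a, c}]; their only common vertex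
    is [a], so the triple can be recovered. *)
Lemma pair_meet_count n :
  n * (n - 1) * (n - 2) <= \sum_(e : pair_vertex n) \sum_f (pair_meet e f : nat).
Proof.
rewrite triples_count; set U := finset _.
pose D := [set p : pair_vertex n * pair_vertex n | pair_meet p.1 p.2].
have -> : \sum_(e : pair_vertex n) \sum_f (pair_meet e f : nat) = #|D|.
  rewrite pair_big /= -sum1dep_card [RHS]big_mkcond.
  by apply: eq_bigr => p _; case: (pair_meet _ _).
(* The values are bare sets, since a [pair_vertex] would require a proof that the two entries
   differ. *)
pose h (p : 'I_n * 'I_n * 'I_n) := ([set p.1.1; p.1.2], [set p.1.1; p.2]).
have hinj : {in U &, injective h}.
  move=> [[a b] c] [[a' b'] c']; rewrite !finset.inE /= /h /=.
  move=> /and3P[ba ca cb] /and3P[ba' ca' cb'] [E1 E2].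
  have aa : a' = a.
    have : a' \in [set a; b] by rewrite E1 !finset.inE eqxx.
    have : a' \in [set a; c] by rewrite E2 !finset.inE eqxx.
    rewrite !finset.inE => /orP[/eqP//|/eqP ->] /orP[/eqP//|].
    by rewrite (negbTE cb).
  subst a'; have : b' \in [set a; b] by rewrite E1 !finset.inE eqxx orbT.
  have : c' \in [set a; c] by rewrite E2 !finset.inE eqxx orbT.
  by rewrite !finset.inE (negbTE ba') (negbTE ca') => /eqP -> /eqP ->.
rewrite -(card_in_imset hinj).
apply: leq_trans (leq_imset_card (fun p => (val p.1, val p.2)) D).
apply/subset_leq_card/fintype.subsetP => _ /imsetP[[[a b] c] + ->].
rewrite finset.inE => /and3P[/= ba ca cb].
have [e eE] := pair_vertex_of ba; have [f fE] := pair_vertex_of ca.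
apply/imsetP; exists (e, f); last by rewrite /h /= eE fE.
rewrite finset.inE /pair_meet /= eE fE; apply/andP; split.
  apply: contra cb => /eqP ef.
  have : c \in val e by rewrite ef fE !finset.inE eqxx orbT.
  by rewrite eE !finset.inE (negbTE ca).
by apply/pred0Pn; exists a; rewrite /= !finset.inE eqxx.
Qed.

(* With [d <= n - 4] the orders would cover at most [d (n^2 + n + 2)], fewer
   than [n (n - 1) (n - 2)], ordered pairs of intersecting edges. *)
Lemma interval_order_cover n d (lt : 'I_d -> rel (pair_vertex n)) : 5 <= n ->
  (forall i e f, lt i e f -> pair_meet e f) ->
  (forall i u v u' v', lt i u v -> lt i u' v' -> lt i u v' || lt i u' v) ->
  (forall e f, pair_meet e f -> exists i, lt i e f || lt i f e) ->
  n - 3 <= d.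
Proof.
move=> n5 ltm lt22 cov.
have : n * (n - 1) * (n - 2) <= d * (n * n + n + 2).
  apply: leq_trans (pair_meet_count n) _.
  apply: leq_trans (_ : \sum_(i < d) 2 * \sum_e \sum_f (lt i e f : nat) <= _).
    (* The factor 2 adds each order to its converse, so that a pair comparable either way is
       counted. *)
    have -> : \sum_(i < d) 2 * \sum_e \sum_f (lt i e f : nat) =
        \sum_e \sum_f \sum_(i < d) (lt i e f + lt i f e).
      under [RHS]eq_bigr do rewrite exchange_big /=.
      rewrite [RHS]exchange_big /=; apply: eq_bigr => i _.
      under [RHS]eq_bigr do rewrite big_split /=.
      by rewrite big_split /= [X in _ + X]exchange_big /= mul2n addnn.
    apply: leq_sum => e _; apply: leq_sum => f _.
    have [/cov[i ltef]|//] := boolP (pair_meet e f).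
    rewrite (bigD1 i) //=; case/orP: ltef => ->; lia.
  apply: leq_trans (_ : \sum_(i < d) (n * n + n + 2) <= _).
    by apply: leq_sum => i _; apply: interval_order_count (ltm i) (lt22 i).
  by rewrite sum_nat_const card_ord.
(* For [n = m + 5] and [d <= m + 1], the right side is at most [(m + 1)(m^2 + 11m + 32)], which
   falls short of [(m + 5)(m + 4)(m + 3)] by [4m + 28]. *)
clear -n5; have [m ->] : exists m, n = m + 5 by exists (n - 5); rewrite subnK.
by nia.
Qed.

(** * A representation in dimension n - 2 *)

Section Construction.
Variable m : nat.
Hypothesis m_gt0 : 0 < m.
Implicit Types (e f : pair_vertex m.+2) (a b c : 'I_m.+2) (i : 'I_m).

Definition inner i : 'I_m.+2 := inord i.+1.

(* The sum has a single term when [a \in e]. *)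
Definition partner a e : nat := \sum_(b in val e | b != a) b.

Definition lower i e : nat :=
  if inner i \in val e then partner (inner i) e else (ord0 \in val e : nat).

Definition upper i e : nat :=
  if inner i \in val e then partner (inner i) e
  else m.+1 - (ord_max \in val e : nat).

Lemma inner_val i : inner i = i.+1 :> nat.
Proof. by rewrite /inner inordK // !ltnS ltnW. Qed.

Lemma inner_or_extreme a : [\/ a = ord0, a = ord_max | exists i, a = inner i].
Proof.
have [->|a0] := eqVneq a ord0; first exact: Or31.
have [->|am] := eqVneq a ord_max; first exact: Or32.
have a1 : 0 < a by rewrite lt0n.
have a2 : a < m.+1 by rewrite ltn_neqAle am -ltnS ltn_ord.
have am1 : a.-1 < m by rewrite -ltnS prednK.
by apply: Or33; exists (Ordinal am1); apply: val_inj; rewrite /= inner_val /= prednK.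
Qed.

Lemma partner_val e a b : a != b -> a \in val e -> b \in val e ->
  partner a e = b.
Proof.
move=> ab ae be; rewrite /partner (bigD1 b) /=; last by rewrite be eq_sym.
rewrite big1 ?addn0 // => c /andP[/andP[ce ca] cb].
by case: (pair_vertex_mem ab ae be ce) => E; rewrite E eqxx in ca cb.
Qed.

Lemma inner_val0 i : inner i != ord0.
Proof. by rewrite -val_eqE /= inner_val. Qed.

Lemma inner_val_max i : inner i != ord_max.
Proof. by rewrite -val_eqE /= inner_val eqSS neq_ltn ltn_ord. Qed.

(** With [e = f] this makes intervals nonempty; used in both directions it makes those of disjoint
    edges meet. An endpoint cut off because of an extreme vertex could only be the point of an edge
    through that same vertex. *)
Lemma lower_le_upper i e f : (e == f) || [disjoint val e & val f] ->
  lower i e <= upper i f.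
Proof.
move=> ef; rewrite /lower /upper.
have part (g : pair_vertex m.+2) : inner i \in val g -> exists b, [/\ partner (inner i) g = b,
    b \in val g & b != inner i].
  move=> ig; have [b bi gE] := pair_vertex_split ig.
  have bg : b \in val g by rewrite gE !finset.inE eqxx orbT.
  by exists b; rewrite (@partner_val g _ b) // eq_sym.
case/orP: ef => [/eqP<-|/pred0P dis].
  (* The edge joining both extremes becomes [[1, m]], nonempty by [m_gt0]. *)
  by case: ifP => // _; do 2 case: (_ \in _); lia.
have disj c : c \in val e -> c \in val f -> False.
  by move=> ce cf; have := dis c; rewrite /= ce cf.
case: ifP => ie; case: ifP => jf.
- by case: (disj _ ie jf).
- have [b [-> be _]] := part _ ie.
  have [fm|_] := boolP (ord_max \in val f); last by rewrite subn0 -ltnS ltn_ord.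
  have : b != ord_max by apply/eqP => E; rewrite E in be; apply: (disj _ be fm).
  by rewrite -val_eqE /=; have := ltn_ord b; lia.
- have [b [-> bf _]] := part _ jf.
  have [e0|//] := boolP (ord0 \in val e).
  by rewrite lt0n; apply/eqP => b0; apply: (disj _ e0); rewrite (_ : ord0 = b) //; apply: val_inj.
- by do 2 case: (_ \in _); lia.
Qed.

Lemma separated_inner i e f : pair_meet e f -> inner i \in val e ->
  inner i \in val f -> upper i e < lower i f \/ upper i f < lower i e.
Proof.
move=> ef ie jf; rewrite /lower /upper ie jf.
have [b bi eE] := pair_vertex_split ie; have [c ci fE] := pair_vertex_split jf.
have be : b \in val e by rewrite eE !finset.inE eqxx orbT.
have cf : c \in val f by rewrite fE !finset.inE eqxx orbT.
rewrite (@partner_val e _ b) ?(@partner_val f _ c) 1?eq_sym //.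
apply/orP; rewrite -neq_ltn; apply/negP => /eqP/val_inj bc.
by subst c; apply: (pair_meet_eqF ef _ ie be jf cf); rewrite eq_sym.
Qed.

(** Coordinate [i] sends [e] to the point 0, while [f] avoids [inner i] and so starts at 1. *)
Lemma separated_ord0 i e f : pair_meet e f -> ord0 \in val e ->
  ord0 \in val f -> inner i \in val e -> upper i e < lower i f.
Proof.
move=> ef e0 f0 ie; rewrite /lower /upper ie (@partner_val e _ ord0) ?inner_val0 //.
case: ifP => [jf|_]; last by rewrite f0.
by case: (pair_meet_eqF ef (inner_val0 i)).
Qed.

Lemma separated_ord_max i e f : pair_meet e f -> ord_max \in val e ->
  ord_max \in val f -> inner i \in val e -> upper i f < lower i e.
Proof.
move=> ef em fm ie.
rewrite /lower /upper ie (@partner_val e _ ord_max) ?inner_val_max //.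
case: ifP => [jf|_]; last by rewrite fm subn1.
by case: (pair_meet_eqF ef (inner_val_max i)).
Qed.

(** An inner common end supplies the coordinate. If the common end is extreme, the other two ends
    are distinct and only one extreme vertex remains, so one of them is inner. *)
Lemma separated e f : pair_meet e f ->
  exists i, upper i e < lower i f \/ upper i f < lower i e.
Proof.
move=> ef; have [a ae af] := pair_meet_common ef; have fe := ef.
rewrite pair_meet_sym in fe.
have [[b ba eE] [c ca fE]] := (pair_vertex_split ae, pair_vertex_split af).
have be : b \in val e by rewrite eE !finset.inE eqxx orbT.
have cf : c \in val f by rewrite fE !finset.inE eqxx orbT.
have bc : b != c.
  apply/eqP => bc; subst c.
  by apply: (pair_meet_eqF ef _ ae be af cf); rewrite eq_sym.
case: (inner_or_extreme a) => [a0|am|[i ai]]; last first.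
- by exists i; subst a; exact: separated_inner.
- subst a; case: (inner_or_extreme b) => [b0|bm|[i bi]].
  + case: (inner_or_extreme c) => [c0|cm|[i ci]].
    * by rewrite b0 c0 eqxx in bc.
    * by rewrite cm eqxx in ca.
    * by subst c; exists i; left; exact: separated_ord_max.
  + by rewrite bm eqxx in ba.
  + by subst b; exists i; right; exact: separated_ord_max.
- subst a; case: (inner_or_extreme b) => [b0|bm|[i bi]].
  + by rewrite b0 eqxx in ba.
  + case: (inner_or_extreme c) => [c0|cm|[i ci]].
    * by rewrite c0 eqxx in ca.
    * by rewrite bm cm eqxx in bc.
    * by subst c; exists i; right; exact: separated_ord0.
  + by subst b; exists i; left; exact: separated_ord0.
Qed.

Lemma kneser2_box_representable (R : realType) :
  box_representable R (kneser2 m.+2) m.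
Proof.
pose I e i : set R := `[(lower i e)%:R%R, (upper i e)%:R%R]%classic.
exists (fun e => [set x : 'rV[R]_m | forall i, I e i (x ord0 i)]%classic).
have IP e i x : I e i x <-> ((lower i e)%:R <= x <= (upper i e)%:R)%R.
  by rewrite /I /= in_itv.
split=> [e|e f ef].
  exists (I e) => // i; split.
  - exact: interval_is_interval.
  - exact: interval_closed.
  - exists (lower i e)%:R%R; apply/IP.
    by rewrite lexx ler_nat lower_le_upper ?eqxx.
rewrite /= /pair_disjoint; split=> [dis|[x [xe xf]]].
  (* In each coordinate the larger left endpoint lies in both intervals. *)
  exists (\row_i (maxn (lower i e) (lower i f))%:R)%R; split=> i; apply/IP.
    rewrite mxE !ler_nat leq_maxl geq_max !lower_le_upper ?eqxx //.
    by rewrite disjoint_sym dis orbT.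
  rewrite mxE !ler_nat leq_maxr geq_max !lower_le_upper ?eqxx //.
  by rewrite dis orbT.
apply/negPn/negP => ndis.
have /separated[i] : pair_meet e f by rewrite /pair_meet ndis andbT.
have /IP/andP[le eu] := xe i; have /IP/andP[lf fu] := xf i.
have := le_trans lf eu; have := le_trans le fu; rewrite !ler_nat.
by move=> h1 h2; case; rewrite ltnNge ?h1 ?h2.
Qed.

End Construction.

(** * The lower bound *)

(** The order of one pair of points decides: a reversed pair would trap a point of one set between
    two points of the other. *)
Lemma disjoint_intervals (R : realType) (I J : set R) :
  is_interval I -> is_interval J -> (I !=set0)%classic -> (J !=set0)%classic ->
  ~ (exists2 x, I x & J x) ->
  (forall x y, I x -> J y -> (x < y)%R) \/ (forall y x, J y -> I x -> (y < x)%R).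
Proof.
have aux (A B : set R) a b : is_interval A -> is_interval B ->
    ~ (exists2 x, A x & B x) -> A a -> B b -> (a < b)%R ->
    forall x y, A x -> B y -> (x < y)%R.
  move=> iA iB AB Aa Bb ab x y Ax By; rewrite ltNge; apply/negP => yx.
  apply: AB; have [bx|xb] := leP b x.
    by exists b => //; apply: (iA _ _ Aa Ax); rewrite (ltW ab).
  by exists x => //; apply: (iB _ _ By Bb); rewrite yx (ltW xb).
move=> iI iJ [a Ia] [b Jb] IJ; have [ab|ba|ab] := ltgtP a b.
- by left; exact: (aux I J a b).
- by right; apply: (aux J I b a) => // -[x Jx Ix]; apply: IJ; exists x.
- by case: IJ; exists a => //; rewrite ab.
Qed.

Lemma kneser2_box_dimension (R : realType) n d : 5 <= n ->
  box_representable R (kneser2 n) d -> n - 3 <= d.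
Proof.
move=> n5 [B [Bbox Badj]].
have /choice[I IP] : forall v, exists I : 'I_d -> set R,
    (forall i, closed_interval (I i)) /\
    B v = [set x : 'rV[R]_d | forall i, I i (x ord0 i)]%classic.
  by move=> v; have [I cI BI] := Bbox v; exists I.
have Iint v i : is_interval (I v i) by have [] := (IP v).1 i.
have Inonempty v i : (I v i !=set0)%classic by have [] := (IP v).1 i.
pose lt i u v := `[< forall x y, I u i x -> I v i y -> (x < y)%R >].
have ltP i u v : reflect (forall x y, I u i x -> I v i y -> (x < y)%R) (lt i u v).
  exact: asboolP.
apply: (@interval_order_cover n d lt n5) => [i u v /ltP uv|i u v u' v' /ltP uv /ltP uv'|u v].
- have neq : u != v.
    apply/eqP => E; subst v; have [x ux] := Inonempty u i.
    by have := uv x x ux ux; rewrite ltxx.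
  rewrite /pair_meet neq; apply/negP => /((Badj u v neq).1)[x].
  rewrite (IP u).2 (IP v).2 => -[xu xv].
  by have := uv _ _ (xu i) (xv i); rewrite ltxx.
(* If [w <= z], all [x] of [u] and [y] of [v'] satisfy [x < w <= z < y], so [u] precedes [v'] after
   all. *)
- apply/orP; have [/ltP|/ltP] := boolP (lt i u v'); first by left.
  move=> nuv; right; apply/ltP => z w u'z vw; rewrite ltNge; apply/negP => wz.
  apply: nuv => x y ux v'y.
  exact: lt_trans (uv _ _ ux vw) (le_lt_trans wz (uv' _ _ u'z v'y)).
- case/andP=> neq ndis; apply: contrapT => nolt.
  (* Intervals meeting in every coordinate give a common point of the boxes, assembled
     coordinatewise. *)
  have meet i : exists x, I u i x /\ I v i x.
    apply: contrapT => nmeet; apply: nolt; exists i; apply/orP.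
    have [||||[x ux vx]|uv|vu] := @disjoint_intervals R (I u i) (I v i) => //.
    + by apply: nmeet; exists x.
    + by left; apply/ltP.
    + by right; apply/ltP.
  have [x xP] := choice meet.
  have/(Badj u v neq).2 : (B u `&` B v !=set0)%classic.
    exists (\row_i x i)%R; rewrite (IP u).2 (IP v).2.
    by split=> i; rewrite mxE; have [] := xP i.
  by rewrite /= /pair_disjoint (negbTE ndis).
Qed.

Theorem corollary1p4 (R : realType) (n : nat) (hn : (5 <= n)%N) :
  is_boxicity R (kneser2 n) (n - 3)%N \/ is_boxicity R (kneser2 n) (n - 2)%N.
Proof.
have low d : box_representable R (kneser2 n) d -> n - 3 <= d.
  exact: kneser2_box_dimension.
have up : box_representable R (kneser2 n) (n - 2).
  have n2 : n = (n - 2).+2 by lia.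
  rewrite {1}n2; apply: kneser2_box_representable; lia.
have [rep|nrep] := pselect (box_representable R (kneser2 n) (n - 3)).
  by left.
(* Dimension [n - 3] fails, so the bound [low] improves by one. *)
right; split=> // d rep; have := low d rep.
rewrite leq_eqVlt => /predU1P[E|]; last by lia.
by case: nrep; rewrite E.
Qed.
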